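(* Let $m,m'\ge 0$ be integers, let $\mathcal T,\mathcal T'$ be reduced T-meshes, and let $\mathbf r,\mathbf r'$ be smoothness distributions on $\mathcal T,\mathcal T'$, respectively, each constant along each maximal segment. Let $\alpha:\widehat{\operatorname{MS}}(\mathcal T)\to\widehat{\operatorname{MS}}(\mathcal T')$ be a direction-preserving structural isomorphism such that corresponding edges have the same smoothness orders under $\mathbf r$ and $\mathbf r'$. Then $$\alpha\bigl(\operatorname{CNDC}_{m,m'}^{\mathbf r}(\mathcal T)\bigr)=\operatorname{CNDC}_{m,m'}^{\mathbf r'}(\mathcal T').$$
   Context: **T-meshes.** Coordinates on $\mathbb R^2$ are $(s,t)$, with $s$ horizontal and $t$ vertical. Let $\Omega\subset\mathbb R^2$ be a finite union of closed axis-aligned rectangles with pairwise disjoint interiors, with $\Omega$ simply connected and $\Omega^\circ$ connected. A T-mesh on $\Omega$ is a triple $\mathcal T=(\mathcal T_2,\mathcal T_1,\mathcal T_0)$: $\mathcal T_2$ is the finite set of these closed rectangles (cells); $\mathcal T_1=\mathcal T_1^h\cup\mathcal T_1^v$ is a finite set of closed horizontal and vertical segments (edges) contained in $\bigcup_{\sigma\in\mathcal T_2}\partial\sigma$; $\mathcal T_0$ is the set of endpoints of edges (vertices); each $\partial\sigma$ is a finite union of edges; distinct cells $\sigma,\sigma'$ satisfy $\sigma\cap\sigma'=\partial\sigma\cap\partial\sigma'$, a finite union of edges and vertices; distinct edges meet only in vertices. Interior edges $\mathcal T_1^\circ$ are the edges meeting $\Omega^\circ$; the other edges are boundary edges. Interior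 vertices $\mathcal T_0^\circ$ are the vertices in $\Omega^\circ$. (Different T-meshes may live on different domains $\Omega$.) **Maximal segments.** A segment is a connected union of edges lying on one straight line. $\operatorname{MS}(\mathcal T)$ is the set of maximal segments consisting of interior edges. Such a segment is a cross-cut if both endpoints lie on $\partial\Omega$, a ray if exactly one does, and a maximal interior segment (MIS) if it does not meet $\partial\Omega$; these sets are $\operatorname{CC}(\mathcal T)$, $\operatorname{Ray}(\mathcal T)$, $\operatorname{MIS}(\mathcal T)$. A boundary maximal segment is a maximal connected union of boundary edges on one line; their set is $\operatorname{BMS}(\mathcal T)$. $\widehat{\operatorname{MS}}(\mathcal T)$ is the disjoint union of these four sets. $\mathcal T$ is reduced if no vertex is inserted merely to divide a straight edge into two collinear edges, every vertex lies on exactly one horizontal and exactly one vertical member of $\widehat{\operatorname{MS}}(\mathcal T)$, and the edges are exactly the closed subsegments between consecutive vertices on these members (so an interior and a boundary maximal segment of the same direction never meet collinearly at a common endpoint). **Structural isomorphism.** For $\rho\in\widehat{\operatorname{MS}}(\mathcal T)$ let $\operatorname{cor}(\rho)$ be its constant $t$-coordinate if horizontal, its constant $s$-coordinate if vertical. A bijection $\alpha:\widehat{\operatorname{MS}}(\mathcal T)\to\widehat{\operatorname{MS}}(\mathcal T')$ is a structural isomorphism if (i) it maps $\operatorname{CC},\operatorname{Ray},\operatorname{MIS},\operatorname{BMS}$ of $\mathcal T$ onto those of $\mathcal T'$; (ii) for distinct $\rho,\eta$: $\rho\cap\eta\ne\varnothing\iff\alpha(\rho)\cap\alpha(\eta)\neq\varnothing$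 (nonempty intersections are vertices, and one sets $\alpha_0(\rho\cap\eta):=\alpha(\rho)\cap\alpha(\eta)$); (iii) $\rho\parallel\eta\iff\alpha(\rho)\parallel\alpha(\eta)$, and for parallel segments $\operatorname{cor}(\rho)<\operatorname{cor}(\eta)\iff\operatorname{cor}(\alpha(\rho))<\operatorname{cor}(\alpha(\eta))$. It is direction-preserving if it maps horizontal segments to horizontal ones and vertical to vertical ones. It induces bijections $\alpha_0$ of vertices, $\alpha_1$ of edges (the edge between consecutive vertices $\gamma,\gamma'$ of $\rho$ goes to the edge of $\alpha(\rho)$ between $\alpha_0(\gamma),\alpha_0(\gamma')$) and of cells; ''corresponding edges have the same smoothness orders'' means $\mathbf r'(\alpha_1(\tau))=\mathbf r(\tau)$ for every $\tau\in\mathcal T_1^\circ$. **Smoothness.** A smoothness distribution is a map $\mathbf r:\mathcal T_1\to\{-1,0,1,\dots\}$ equal to $-1$ on boundary edges. It is constant along each maximal segment if for every $\rho\in\operatorname{MS}(\mathcal T)$ all edges $\tau\subset\rho$ have the same value $\mathbf r(\tau)=:r(\rho)$. For $\gamma\in\mathcal T_0^\circ$ with horizontal and vertical maximal segments $\rho_h(\gamma),\rho_v(\gamma)$ through it, $r_h(\gamma):=r(\rho_v(\gamma))$ and $r_v(\gamma):=r(\rho_h(\gamma))$. **Absolute weights.** A deletion state is a pair $(\mathcal A,\mathcal B)$ with $\mathcal A\cap\mathcal B=\varnothing$, $\mathcal A\cup\mathcal B=\operatorname{MIS}(\mathcal T)$. For $\rho\in\mathcal A$, $\operatorname{Mono}_{(\mathcal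 A,\mathcal B)}(\rho)$ is the set of vertices on $\rho$ lying on no MIS in $\mathcal A\setminus\{\rho\}$. With $(a)_+=\max\{a,0\}$, $\mu_h(\gamma)=(m-r_h(\gamma))_+$, $\mu_v(\gamma)=(m'-r_v(\gamma))_+$. The absolute weight $\Omega_{(\mathcal A,\mathcal B)}(\rho)$ is $\sum_{\gamma\in\operatorname{Mono}_{(\mathcal A,\mathcal B)}(\rho)}\mu_h(\gamma)$ for $\rho$ horizontal and $\sum_{\gamma\in\operatorname{Mono}_{(\mathcal A,\mathcal B)}(\rho)}\mu_v(\gamma)$ for $\rho$ vertical. The threshold is $\theta(\rho)=m+1$ for $\rho$ horizontal, $m'+1$ for $\rho$ vertical. An MIS $\rho\in\mathcal A$ is diagonalizable at $(\mathcal A,\mathcal B)$ if $\Omega_{(\mathcal A,\mathcal B)}(\rho)\ge\theta(\rho)$. **Deletion algorithm and weighted CNDC.** Start with $\mathcal A=\operatorname{MIS}(\mathcal T)$, $\mathcal B=\varnothing$. In each pass let $\mathcal Z$ be the set of all $\rho\in\mathcal A$ diagonalizable at $(\mathcal A,\mathcal B)$, and replace $\mathcal A$ by $\mathcal A\setminus\mathcal Z$ and $\mathcal B$ by $\mathcal B\cup\mathcal Z$; repeat until a pass has $\mathcal Z=\varnothing$. The final $\mathcal A$ is the weighted CNDC $\operatorname{CNDC}_{m,m'}^{\mathbf r}(\mathcal T)$. *)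

(* Defs.v *)
From HB Require Import structures.
From mathcomp Require Import all_boot all_order all_algebra finmap.
From mathcomp Require Import lra.
From mathcomp Require Import all_classical all_reals all_analysis.
Set Implicit Arguments.
Unset Strict Implicit.
Unset Printing Implicit Defensive.
Import Order.TTheory GRing.Theory Num.Theory.
Import numFieldNormedType.Exports.
Local Open Scope classical_set_scope.
Local Open Scope ring_scope.

(* Points of R * R are pairs (s, t), with s horizontal and t vertical. *)

Section Topology.
Variable R : realType.
Implicit Types A : set (R * R).

Definition boundary A : set (R * R) := closure A `\` interior A.

Definition path_connected A : Prop :=
  forall p q, A p -> A q -> exists f : R -> R * R,
    [/\ {within `[0, 1], continuous f}, f @` `[0, 1] `<=` A, f 0 = p & f 1 = q].

Definition loops_contract A : Prop :=
  forall f : R -> R * R,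
    {within `[0, 1], continuous f} -> f @` `[0, 1] `<=` A -> f 0 = f 1 ->
  exists H : R * R -> R * R,
    [/\ {within `[0, 1] `*` `[0, 1], continuous H},
        H @` (`[0, 1] `*` `[0, 1]) `<=` A,
        forall x, x \in `[0, 1] -> H (x, 0) = f x,
        forall x, x \in `[0, 1] -> H (x, 1) = f 0 &
        forall u, u \in `[0, 1] -> H (0, u) = f 0 /\ H (1, u) = f 0].

Definition simply_connected A : Prop := path_connected A /\ loops_contract A.

End Topology.

Record rect (R : realType) := Rect {
  s_min : R; s_max : R; t_min : R; t_max : R;
  s_min_lt_max : s_min < s_max;
  t_min_lt_max : t_min < t_max }.

Definition rect_set (R : realType) (c : rect R) : set (R * R) :=
  `[s_min c, s_max c] `*` `[t_min c, t_max c].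

(* A nondegenerate closed segment: [lo, hi] x {cor} if horizontal,
   {cor} x [lo, hi] if vertical. *)
Record seg (R : realType) := Seg {
  horizontal : bool; cor : R; lo : R; hi : R;
  lo_lt_hi : lo < hi }.

HB.instance Definition _ (R : realType) := gen_eqMixin (seg R).
HB.instance Definition _ (R : realType) := gen_choiceMixin (seg R).
HB.instance Definition _ (R : realType) :=
  isPointed.Build (seg R) (Seg true 0 (@ltr01 R)).

Section Segments.
Variable R : realType.
Implicit Types x y : seg R.

Definition on_line x (a : R) : R * R :=
  if horizontal x then (a, cor x) else (cor x, a).
Definition seg_set x : set (R * R) := on_line x @` `[lo x, hi x].
Definition endpoints x : set (R * R) := [set on_line x (lo x); on_line x (hi x)].

Definition parallel x y : bool := horizontal x == horizontal y.
Definition collinear x y : bool := parallel x y && (cor x == cor y).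

End Segments.

Definition domain_of (R : realType) (C : set (rect R)) : set (R * R) :=
  \bigcup_(c in C) rect_set c.
Definition endpoints_of (R : realType) (E : set (seg R)) : set (R * R) :=
  \bigcup_(e in E) endpoints e.

Record tmesh (R : realType) := TMesh {
  cells : set (rect R);
  edges : set (seg R);
  finite_cells : finite_set cells;
  disjoint_cells : forall c d, cells c -> cells d -> c <> d ->
    interior (rect_set c) `&` interior (rect_set d) = set0;
  simply_connected_domain : simply_connected (domain_of cells);
  connected_interior : connected (interior (domain_of cells));
  finite_edges : finite_set edges;
  edges_on_boundaries : forall e, edges e ->
    seg_set e `<=` \bigcup_(c in cells) boundary (rect_set c);
  cell_boundary : forall c, cells c -> exists2 E : set (seg R),
    E `<=` edges & boundary (rect_set c) = \bigcup_(e in E) seg_set e;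
  cells_meet_in_boundary : forall c d, cells c -> cells d -> c <> d ->
    rect_set c `&` rect_set d = boundary (rect_set c) `&` boundary (rect_set d);
  cells_meet : forall c d, cells c -> cells d -> c <> d ->
    exists (E : set (seg R)) (V : set (R * R)),
    [/\ E `<=` edges, V `<=` endpoints_of edges &
        rect_set c `&` rect_set d = (\bigcup_(e in E) seg_set e) `|` V];
  edges_meet : forall e f, edges e -> edges f -> e <> f ->
    seg_set e `&` seg_set f `<=` endpoints_of edges }.

Section Mesh.
Variables (R : realType) (T : tmesh R).

Definition domain : set (R * R) := domain_of (cells T).
Definition vertices : set (R * R) := endpoints_of (edges T).

Definition interior_edges : set (seg R) :=
  [set e | edges T e /\ seg_set e `&` interior domain !=set0].
Definition boundary_edges : set (seg R) := edges T `\` interior_edges.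

(* A [seg] is connected and contained in one line, so it is enough to ask that
   it be a union of members of [E]. *)
Definition segment_of (E : set (seg R)) (x : seg R) : Prop :=
  exists2 F : set (seg R), F `<=` E & seg_set x = \bigcup_(e in F) seg_set e.
Definition maximal_segments (E : set (seg R)) : set (seg R) :=
  [set x | segment_of E x /\
     forall y, segment_of E y -> seg_set x `<=` seg_set y -> y = x].

Definition MS : set (seg R) := maximal_segments interior_edges.
Definition BMS : set (seg R) := maximal_segments boundary_edges.

Definition CC : set (seg R) :=
  [set x | MS x /\ endpoints x `<=` boundary domain].
Definition Ray : set (seg R) :=
  [set x | MS x /\ exists! p, endpoints x p /\ boundary domain p].
Definition MIS : set (seg R) :=
  [set x | MS x /\ seg_set x `&` boundary domain = set0].

(* The four sets are pairwise disjoint: members of [BMS] miss the interior of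
   the domain, members of [MS] meet it. *)
Definition hMS : set (seg R) := CC `|` Ray `|` MIS `|` BMS.

Definition reduced : Prop :=
  [/\ forall g, vertices g -> ~ exists e f,
        [/\ e <> f, collinear e f &
            [set x | edges T x /\ seg_set x g] = [set e; f]],
      forall g, vertices g ->
        (exists! x, [/\ hMS x, horizontal x & seg_set x g]) /\
        (exists! x, [/\ hMS x, ~~ horizontal x & seg_set x g]) &
      edges T = [set e | vertices `&` seg_set e = endpoints e /\
                         exists2 x, hMS x & seg_set e `<=` seg_set x]].

Lemma vertices_endpoints E x : E `<=` edges T -> segment_of E x ->
  endpoints x `<=` vertices.
Proof.
move=> ET [F FE xF].
have key a : lo x <= a <= hi x -> exists e,
    [/\ F e, horizontal e = horizontal x & cor e = cor x] /\
    [/\ lo x <= lo e, lo e <= a, a <= hi e & hi e <= hi x].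
  move=> ax; have : seg_set x (on_line x a) by exists a; rewrite //= in_itv.
  rewrite xF => -[e Fe ea]; exists e.
  have ex : seg_set e `<=` seg_set x by rewrite xF => p ep; exists e.
  have eb b : lo e <= b <= hi e -> exists2 c, lo x <= c <= hi x & on_line x c = on_line e b.
    move=> be; have : seg_set e (on_line e b) by exists b; rewrite //= in_itv.
    by move=> /ex[c /=]; rewrite in_itv /= => ? ?; exists c.
  have le := ltW (lo_lt_hi e).
  have [] := eb (lo e); first by rewrite lexx.
  have [] := eb (hi e); first by rewrite lexx andbT.
  have := lo_lt_hi e; case: ea => a' /=; rewrite in_itv /=.
  rewrite /on_line; case: (horizontal e); case: (horizontal x) => /andP[l1 l2] [] E1 E2 ll.
  - move=> c /andP[c1 c2] [ch _] d /andP[d1 d2] [dl co].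
    by split; split => //; lra.
  - by move=> c _ [h1 _] d _ [h2 _]; move: ll; rewrite -h1 -h2 ltxx.
  - by move=> c _ [_ h1] d _ [_ h2]; move: ll; rewrite -h1 -h2 ltxx.
  - move=> c /andP[c1 c2] [co ch] d /andP[d1 d2] [_ dl].
    by split; split => //; lra.
have lx := ltW (lo_lt_hi x).
move=> p [] ->.
  have [|e [[Fe he ce] [l1 l2 _ _]]] := key (lo x); first by rewrite lexx lx.
  exists e; first by apply/ET/FE.
  by left; rewrite /on_line he ce (@le_anti _ _ (lo x) (lo e)) // l1 l2.
have [|e [[Fe he ce] [_ _ l1 l2]]] := key (hi x); first by rewrite lexx lx.
exists e; first by apply/ET/FE.
by right; rewrite /on_line he ce (@le_anti _ _ (hi x) (hi e)) // l1 l2.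
Qed.

Lemma finite_vertices : finite_set vertices.
Proof.
by apply: bigcup_finite; [exact: finite_edges|move=> e _; exact: finite_set2].
Qed.

Lemma finite_MIS : finite_set MIS.
Proof.
pose key (x : seg R) := (horizontal x, (on_line x (lo x), on_line x (hi x))).
have key_inj : injective key.
  case=> h c l u lu [h' c' l' u' lu']; rewrite /key /on_line /= => -[<-].
  by case: h => -[? ?] [? ?]; subst; rewrite (bool_irrelevance lu lu').
have := finite_setX (@finite_finset _ [set: bool])
  (finite_setX finite_vertices finite_vertices).
move=> /(finite_preimage (fun x y _ _ => @key_inj x y)).
apply: sub_finite_set => x [[xs _] _].
have xv : endpoints x `<=` vertices by apply: vertices_endpoints xs => e [].
by split => //; split; apply: xv; [left|right].
Qed.

Definition rho_h (g : R * R) : seg R :=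
  get [set x | [/\ hMS x, horizontal x & seg_set x g]].
Definition rho_v (g : R * R) : seg R :=
  get [set x | [/\ hMS x, ~~ horizontal x & seg_set x g]].

Definition smoothness_distribution (r : seg R -> int) : Prop :=
  (forall e, edges T e -> -1 <= r e) /\
  (forall e, boundary_edges e -> r e = -1).

Definition constant_along_MS (r : seg R -> int) : Prop :=
  forall x, MS x -> forall e f, edges T e -> edges T f ->
    seg_set e `<=` seg_set x -> seg_set f `<=` seg_set x -> r e = r f.

Section Deletion.
Variables (r : seg R -> int) (m m' : nat).

(* The common value of [r] on the edges contained in [x]. *)
Definition r_seg (x : seg R) : int :=
  r (get [set e | edges T e /\ seg_set e `<=` seg_set x]).
Definition r_h (g : R * R) : int := r_seg (rho_v g).
Definition r_v (g : R * R) : int := r_seg (rho_h g).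

Definition mu_h (g : R * R) : int := Num.max (m%:Z - r_h g) 0.
Definition mu_v (g : R * R) : int := Num.max (m'%:Z - r_v g) 0.

Definition state := (set (seg R) * set (seg R))%type.

Definition deletion_state (S : state) : Prop :=
  S.1 `&` S.2 = set0 /\ S.1 `|` S.2 = MIS.

Definition Mono (S : state) (x : seg R) : set (R * R) :=
  [set g | [/\ vertices g, seg_set x g &
               forall y, (S.1 `\ x) y -> ~ seg_set y g]].

Definition abs_weight (S : state) (x : seg R) : int :=
  if horizontal x then \sum_(g \in Mono S x) mu_h g
  else \sum_(g \in Mono S x) mu_v g.

Definition threshold (x : seg R) : int :=
  if horizontal x then m.+1%:Z else m'.+1%:Z.

Definition diagonalizable (S : state) : set (seg R) :=
  [set x | S.1 x /\ threshold x <= abs_weight S x].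

Definition pass (S : state) : state :=
  (S.1 `\` diagonalizable S, S.2 `|` diagonalizable S).

Definition deletion_run (n : nat) : state := iter n pass (MIS, set0).

Definition first_stop : nat :=
  get [set n | diagonalizable (deletion_run n) = set0 /\
     forall k, (k < n)%N -> diagonalizable (deletion_run k) <> set0].

Definition CNDC : set (seg R) := (deletion_run first_stop).1.

Lemma deletion_run_state n : deletion_state (deletion_run n).
Proof.
elim: n => [|n]; first by split; rewrite /= ?setI0 ?setU0.
rewrite /deletion_run iterS -/(deletion_run n) /pass.
case: (deletion_run n) => A B [/= AB0 AB]; set D := diagonalizable _.
have DA : D `<=` A by move=> x [].
split => /=.
  apply/seteqP; split => // x [] [Ax Dx] [Bx|//].
  by rewrite -AB0; split.
rewrite -AB; apply/seteqP; split => x.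
  by case=> [[Ax _]|[Bx|/DA Ax]]; [left|right|left].
case=> [Ax|Bx]; last by right; left.
by have [Dx|nDx] := pselect (D x); [right; right|left; split].
Qed.

Lemma deletion_stops :
  exists n, diagonalizable (deletion_run n) = set0.
Proof.
have stops c : forall S : state,
    finite_set S.1 -> (#|` fset_set S.1| <= c)%N ->
    exists n, diagonalizable (iter n pass S) = set0.
  elim: c => [|c IH] S finS.
    rewrite leqn0 cardfs_eq0 => /eqP S0; exists 0%N.
    rewrite -subset0 => x [/= Sx _].
    have : x \in fset_set S.1 by rewrite in_fset_set // mem_set.
    by rewrite S0 inE.
  move=> cardS; have [D0|/set0P[x Dx]] := eqVneq (diagonalizable S) set0.
    by exists 0%N.
  have finS' : finite_set (pass S).1.
    by apply: sub_finite_set finS => y [].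
  have [//|n Dn] := IH (pass S) finS'; last by exists n.+1; rewrite iterSr.
  rewrite -ltnS; apply: leq_trans cardS; apply: fproper_ltn_card.
  rewrite fproperE; apply/andP; split.
    by apply/fsubsetP => y; rewrite !in_fset_set // !inE => -[].
  apply/negP => /fsubsetP /(_ x).
  rewrite !in_fset_set // !inE => /(_ (proj1 Dx)) [_].
  exact.
exact: (stops _ (MIS, set0) finite_MIS (leqnn _)).
Qed.

Lemma first_stopP : diagonalizable (deletion_run first_stop) = set0 /\
  forall k, (k < first_stop)%N -> diagonalizable (deletion_run k) <> set0.
Proof.
rewrite /first_stop; set P := [set n | _].
suff [n Pn] : exists n, P n by exact: (@getI _ P n Pn).
have [n /asboolP sn] := deletion_stops.
have ex : exists n, `[< diagonalizable (deletion_run n) = set0 >] by exists n.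
case: (ex_minnP ex) => k /asboolP Dk kmin; exists k; split => // j jk Dj.
by have := kmin j (asboolT Dj); rewrite leqNgt jk.
Qed.

End Deletion.
End Mesh.

Section Isomorphism.
Variables (R : realType) (T T' : tmesh R) (alpha : seg R -> seg R).

(* Only the restriction of [alpha] to [hMS T] matters. *)
Definition structural_isomorphism : Prop :=
  [/\ set_bij (hMS T) (hMS T') alpha,
      [/\ alpha @` CC T = CC T', alpha @` Ray T = Ray T',
          alpha @` MIS T = MIS T' & alpha @` BMS T = BMS T'],
      forall x y, hMS T x -> hMS T y -> x <> y ->
        (seg_set x `&` seg_set y !=set0 <->
         seg_set (alpha x) `&` seg_set (alpha y) !=set0),
      forall x y, hMS T x -> hMS T y ->
        parallel x y = parallel (alpha x) (alpha y) &
      forall x y, hMS T x -> hMS T y -> parallel x y ->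
        (cor x < cor y) = (cor (alpha x) < cor (alpha y))].

Definition direction_preserving : Prop :=
  forall x, hMS T x -> horizontal (alpha x) = horizontal x.

(* In a reduced mesh the segments through the vertex [g] are [rho_h g] and
   [rho_v g], and [g] is their intersection. *)
Definition alpha0 (g : R * R) : R * R :=
  get (seg_set (alpha (rho_h T g)) `&` seg_set (alpha (rho_v T g))).

(* For an edge [e] on the maximal segment [x], the edge of [alpha x] between
   the images of the endpoints of [e]. *)
Definition alpha1 (e : seg R) : seg R :=
  get [set f | [/\ edges T' f, endpoints f = alpha0 @` endpoints e &
    exists x, [/\ hMS T x, seg_set e `<=` seg_set x &
                  seg_set f `<=` seg_set (alpha x)]]].

Definition same_smoothness (r r' : seg R -> int) : Prop :=
  forall e, interior_edges T e -> r' (alpha1 e) = r e.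

End Isomorphism.

(* Main.v *)
(** The isomorphism [alpha] determines a bijection [alpha0] between the vertices
    of the two meshes, since a vertex is the crossing point of the two members
    of [hMS] through it.  It preserves incidence, and it preserves the order of
    the coordinates because the coordinates of a vertex are those of the two
    segments.  Hence consecutive vertices go to consecutive vertices, so that
    edges go to edges and the smoothness orders of the segments agree; then
    [Mono], the weights and every pass of the deletion algorithm correspond. *)
Require Import Defs.
From mathcomp Require Import all_boot all_order all_algebra.
From mathcomp Require Import all_classical all_reals all_analysis.
Local Open Scope classical_set_scope.

(** * Coordinates and points of a single segment *)

Section SegmentGeometry.
Set Implicit Arguments.
Unset Strict Implicit.
Import Order.TTheory GRing.Theory Num.Theory.
Local Open Scope ring_scope.
Variable R : realType.
Implicit Types (x y e f : seg R) (p q : R * R) (b : bool).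

(** The flag is a direction: along a segment [x], [coord (horizontal x)] varies and
    [coord (~~ horizontal x)] stays equal to [cor x]. This lets one argument serve both
    directions. *)
Definition coord b p : R := if b then p.1 else p.2.

Lemma coord_inj p q : (forall b, coord b p = coord b q) -> p = q.
Proof.
by move=> pq; case: p q pq => [s t] [s' t'] /[dup] /(_ true) /= -> /(_ false) /= ->.
Qed.

Lemma seg_setE x p : seg_set x p <->
  lo x <= coord (horizontal x) p <= hi x /\ coord (~~ horizontal x) p = cor x.
Proof.
rewrite /seg_set /on_line /coord; split.
  by case=> a /=; rewrite in_itv /= => ax <-; case: (horizontal x).
case: p => s t [xp cp]; exists (coord (horizontal x) (s, t)).
  by rewrite /= in_itv.
by move: cp; rewrite /coord; case: (horizontal x) => /= <-.
Qed.

Lemma seg_set_cor x p : seg_set x p -> coord (~~ horizontal x) p = cor x.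
Proof. by case/seg_setE. Qed.

Lemma coord_on_line x (a : R) : coord (horizontal x) (on_line x a) = a.
Proof. by rewrite /coord /on_line; case: (horizontal x). Qed.

Lemma on_line_cor x (a : R) : coord (~~ horizontal x) (on_line x a) = cor x.
Proof. by rewrite /coord /on_line; case: (horizontal x). Qed.

Lemma on_line_seg x (a : R) : lo x <= a <= hi x -> seg_set x (on_line x a).
Proof. by move=> xa; apply/seg_setE; rewrite coord_on_line on_line_cor. Qed.

Lemma endpoints_seg x : endpoints x `<=` seg_set x.
Proof.
have lx := ltW (lo_lt_hi x).
by move=> p [] ->; apply: on_line_seg; rewrite lexx lx.
Qed.

(** If the directions differed, the coordinate that varies along [e] would be constant on [x],
    forcing [lo e = hi e]. *)
Lemma sub_seg_horizontal e x :
  seg_set e `<=` seg_set x -> horizontal e = horizontal x.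
Proof.
move=> ex; apply/eqP; apply: contraT => ne.
have /ex/seg_set_cor : seg_set e (on_line e (lo e)) by apply: endpoints_seg; left.
have /ex/seg_set_cor : seg_set e (on_line e (hi e)) by apply: endpoints_seg; right.
have -> : ~~ horizontal x = horizontal e.
  by case: (horizontal e) (horizontal x) ne => [] [].
by rewrite !coord_on_line => hE lE; have := lo_lt_hi e; rewrite hE lE ltxx.
Qed.

(** The midpoint works. In a reduced mesh such a point of an edge lies on no other edge. *)
Lemma seg_not_endpoint e : exists2 p, seg_set e p & ~ endpoints e p.
Proof.
have [lm mh] := midf_lt (lo_lt_hi e).
exists (on_line e ((lo e + hi e) / 2)).
  by apply: on_line_seg; rewrite !ltW.
by case=> /(congr1 (coord (horizontal e))); rewrite !coord_on_line => E;
   move: lm mh; rewrite E ltxx.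
Qed.

End SegmentGeometry.

(** * Vertices, edges and smoothness orders in one reduced mesh *)

Section ReducedMesh.
Set Implicit Arguments.
Unset Strict Implicit.
Import Order.TTheory GRing.Theory Num.Theory.
Local Open Scope ring_scope.
Variables (R : realType) (T : tmesh R).
Implicit Types (x y e f : seg R) (g : R * R) (b : bool).

Definition rho b g : seg R := if b then rho_h T g else rho_v T g.

Lemma segment_sub E x : segment_of E x -> exists2 e, E e & seg_set e `<=` seg_set x.
Proof.
case=> F FE xF; have : seg_set x (on_line x (lo x)) by apply: endpoints_seg; left.
by rewrite xF => -[e Fe _]; exists e; [exact: FE|move=> p ep; exists e].
Qed.

Lemma segment_ofS E F x : E `<=` F -> segment_of E x -> segment_of F x.
Proof. by move=> EF [G GE xG]; exists G => // e /GE/EF. Qed.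

Lemma hMS_MS_BMS x : hMS T x -> MS T x \/ BMS T x.
Proof. by move=> [[[]|[]]|]; [case=> ?; left|case=> ?; left|case=> ?; left|right]. Qed.

Lemma hMS_segment x : hMS T x -> segment_of (edges T) x.
Proof. by case/hMS_MS_BMS => -[+ _]; apply: segment_ofS => e []. Qed.

Lemma MIS_hMS : MIS T `<=` hMS T.
Proof. by move=> x; left; right. Qed.

(** The point lies on an edge of [x] and on an edge of [y]. These have different directions, so they
    are distinct and meet only in vertices. *)
Lemma crossing_vertex x y g : hMS T x -> hMS T y ->
  horizontal x <> horizontal y -> seg_set x g -> seg_set y g -> vertices T g.
Proof.
move=> /hMS_segment[E ET xE] /hMS_segment[F FT yF] ne xg yg.
have [e Ee eg] : (\bigcup_(e in E) seg_set e) g by rewrite -xE.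
have [f Ff fg] : (\bigcup_(f in F) seg_set f) g by rewrite -yF.
have ex : seg_set e `<=` seg_set x by rewrite xE => p ep; exists e.
have fy : seg_set f `<=` seg_set y by rewrite yF => p fp; exists f.
apply: (edges_meet (ET _ Ee) (FT _ Ff)) => // ef.
by apply: ne; rewrite -(sub_seg_horizontal ex) -(sub_seg_horizontal fy) ef.
Qed.

Lemma edge_vertices e g : edges T e -> endpoints e g -> vertices T g.
Proof. by move=> Te eg; exists e. Qed.

Hypothesis redT : reduced T.

Lemma rhoP b g : vertices T g ->
  [/\ hMS T (rho b g), horizontal (rho b g) = b & seg_set (rho b g) g].
Proof.
case: redT => _ thru _ /thru[[x [xh _]] [y [yv _]]].
case: b; rewrite /rho /rho_h /rho_v /=; set P := [set x | _].
  by have /getI[] : P x by [].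
have /getI[hP vP gP] : P y by [].
by split => //; apply: negbTE.
Qed.

Lemma rho_unique x g : hMS T x -> vertices T g -> seg_set x g ->
  x = rho (horizontal x) g.
Proof.
case: redT => _ thru _ hx /[dup] /rhoP rhog /thru[[y [_ yh]] [z [_ zv]]] xg.
have [hr hh rg] := rhog (horizontal x); move: hh.
case: (boolP (horizontal x)) hr rg => [xh hr rg rh|xv hr rg rv].
  by rewrite -(yh x) // -(yh (rho true g)).
rewrite -(zv x) // -(zv (rho false g)) //; split => //; by rewrite rv.
Qed.

Lemma cor_rho b g : vertices T g -> cor (rho b g) = coord (~~ b) g.
Proof. by case/(rhoP b) => _ hb /seg_set_cor <-; rewrite hb. Qed.

(** A non-endpoint of [e] lies on some edge [f] in [E]. If [f] were not [e], that point would be a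
    vertex, but a reduced mesh has no vertex on [e] besides its ends. *)
Lemma edge_in_segment E e x : E `<=` edges T -> segment_of E x ->
  edges T e -> seg_set e `<=` seg_set x -> E e.
Proof.
move=> ET [F FE xF] Te ex; have [p ep nep] := seg_not_endpoint e.
have := ex _ ep; rewrite xF => -[f Ff fp].
have [->|/eqP ne] := eqVneq e f; first exact: FE.
case: redT => _ _ edgesT; move: (Te); rewrite edgesT => -[ve _].
exfalso; apply: nep; rewrite -ve; split => //.
exact: (edges_meet Te (ET _ (FE _ Ff)) ne).
Qed.

(** Both segments inherit the direction of [e] and pass through an end of [e], where the member of
    each direction is unique. *)
Lemma hMS_eq x y e : hMS T x -> hMS T y -> edges T e ->
  seg_set e `<=` seg_set x -> seg_set e `<=` seg_set y -> x = y.
Proof.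
move=> hx hy Te ex ey.
have eg : endpoints e (on_line e (lo e)) by left.
have vg := edge_vertices Te eg; have sg := endpoints_seg eg.
rewrite (rho_unique hx vg (ex _ sg)) (rho_unique hy vg (ey _ sg)).
by rewrite -(sub_seg_horizontal ex) -(sub_seg_horizontal ey).
Qed.

Variable r : seg R -> int.

Lemma r_seg_edge x : hMS T x ->
  exists e, [/\ edges T e, seg_set e `<=` seg_set x & r_seg T r x = r e].
Proof.
move=> /hMS_segment/segment_sub[e Te ex]; rewrite /r_seg.
set P := [set e | _]; have /getI[] : P e by [].
by exists (get P).
Qed.

Lemma r_seg_MS x e : constant_along_MS T r -> MS T x -> hMS T x -> edges T e ->
  seg_set e `<=` seg_set x -> r_seg T r x = r e.
Proof.
by move=> rc Mx /r_seg_edge[f [Tf fx ->]] Te ex; exact: rc Mx _ _ Tf Te fx ex.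
Qed.

(** Constancy is assumed only along [MS]. Here the value comes from the fact that every edge
    contained in [x] is a boundary edge. *)
Lemma r_seg_BMS x : smoothness_distribution T r -> BMS T x -> r_seg T r x = -1.
Proof.
move=> [_ rb] Bx; have /r_seg_edge[e [Te ex ->]] : hMS T x by right.
by apply: rb; case: Bx => xs _; apply: edge_in_segment xs Te ex => ? [].
Qed.

End ReducedMesh.

(** * The maps on vertices and edges induced by a structural isomorphism *)

Section Isomorphism.
Set Implicit Arguments.
Unset Strict Implicit.
Import Order.TTheory GRing.Theory Num.Theory.
Local Open Scope ring_scope.
Variables (R : realType) (T T' : tmesh R).
Hypotheses (redT : reduced T) (redT' : reduced T').
Variable alpha : seg R -> seg R.
Hypothesis iso : structural_isomorphism T T' alpha.
Hypothesis dir : direction_preserving T alpha.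
Implicit Types (x y e f : seg R) (g h : R * R) (b : bool).

Local Notation alpha0 := (alpha0 T alpha).

Lemma iso_hMS x : hMS T x -> hMS T' (alpha x).
Proof. by case: iso => -[ahMS _ _] _ _ _ _; exact: ahMS. Qed.

Lemma iso_inj x y : hMS T x -> hMS T y -> alpha x = alpha y -> x = y.
Proof. by case: iso => -[_ inj _] _ _ _ _ hx hy; apply: inj; rewrite inE. Qed.

Lemma iso_surj y : hMS T' y -> exists2 x, hMS T x & alpha x = y.
Proof. by case: iso => -[_ _ surj] _ _ _ _ /surj. Qed.

Lemma iso_MS x : hMS T x -> (MS T x /\ MS T' (alpha x)) \/ (BMS T x /\ BMS T' (alpha x)).
Proof.
case: iso => _ [aCC aRay aMIS aBMS] _ _ _.
case=> [[[|]|]|] X.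
- have : CC T' (alpha x) by rewrite -aCC; exists x.
  by case: X => Mx _ [Mx' _]; left.
- have : Ray T' (alpha x) by rewrite -aRay; exists x.
  by case: X => Mx _ [Mx' _]; left.
- have : MIS T' (alpha x) by rewrite -aMIS; exists x.
  by case: X => Mx _ [Mx' _]; left.
- by right; split => //; rewrite -aBMS; exists x.
Qed.

(** The two segments through [g] meet, so their images meet, and the [get] in [alpha0] picks a
    genuine common point. *)
Lemma alpha0_rho b g : vertices T g -> seg_set (alpha (rho T b g)) (alpha0 g).
Proof.
move=> vg; have [hh ht hg] := rhoP redT true vg; have [vh vf vg'] := rhoP redT false vg.
have ne : rho T true g <> rho T false g by move=> E; move: ht; rewrite E vf.
case: iso => _ _ meet _ _; have [+ _] := meet _ _ hh vh ne.
case; first by exists g.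
move=> p pX.
by have [ah av] : (seg_set (alpha (rho T true g)) `&` seg_set (alpha (rho T false g)))
    (alpha0 g) := getI pX; case: b.
Qed.

Lemma horizontal_alpha_rho b g : vertices T g -> horizontal (alpha (rho T b g)) = b.
Proof. by move=> /(rhoP redT b)[hr hb _]; rewrite dir. Qed.

Lemma alpha0_vertex g : vertices T g -> vertices T' (alpha0 g).
Proof.
move=> vg; have [hh _ _] := rhoP redT true vg; have [hv _ _] := rhoP redT false vg.
apply: (crossing_vertex (iso_hMS hh) (iso_hMS hv)); rewrite ?horizontal_alpha_rho //;
  exact: alpha0_rho.
Qed.

(** The image segment passes through [alpha0 g] in direction [b], and only one member of [hMS T']
    does. *)
Lemma rho_alpha0 b g : vertices T g -> rho T' b (alpha0 g) = alpha (rho T b g).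
Proof.
move=> vg; have [hr _ _] := rhoP redT b vg.
rewrite (rho_unique redT' (iso_hMS hr) (alpha0_vertex vg) (alpha0_rho b vg)).
by rewrite horizontal_alpha_rho.
Qed.

Lemma coord_alpha0 b g : vertices T g ->
  coord b (alpha0 g) = cor (alpha (rho T (~~ b) g)).
Proof.
move=> vg; rewrite -rho_alpha0 // (cor_rho redT' _ (alpha0_vertex vg)).
by rewrite negbK.
Qed.

Lemma coord_alpha0_lt b g h : vertices T g -> vertices T h ->
  (coord b (alpha0 g) < coord b (alpha0 h)) = (coord b g < coord b h).
Proof.
move=> vg vh; rewrite !coord_alpha0 //.
have [hg bg _] := rhoP redT (~~ b) vg; have [hh bh _] := rhoP redT (~~ b) vh.
case: iso => _ _ _ _ ord; rewrite -ord //; last by rewrite /parallel bg bh.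
by rewrite !(cor_rho redT) // negbK.
Qed.

Lemma alpha0_inj g h : vertices T g -> vertices T h -> alpha0 g = alpha0 h -> g = h.
Proof.
move=> vg vh E; apply: coord_inj => b; apply: le_anti.
by rewrite !leNgt -(coord_alpha0_lt b vg vh) -(coord_alpha0_lt b vh vg) E ltxx.
Qed.

(** For the direct implication, [alpha x] and the image of the segment through [g] parallel to [x]
    both pass through [alpha0 g]. They coincide by uniqueness, and [alpha] is injective on
    [hMS T]. *)
Lemma alpha0_incident x g : hMS T x -> vertices T g ->
  seg_set (alpha x) (alpha0 g) <-> seg_set x g.
Proof.
move=> hx vg; have [hr _ rg] := rhoP redT (horizontal x) vg; split=> xg; last first.
  by rewrite (rho_unique redT hx vg xg); exact: alpha0_rho.
have := rho_unique redT' (iso_hMS hx) (alpha0_vertex vg) xg.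
by rewrite rho_alpha0 // dir // => /(iso_inj hx hr) ->.
Qed.

(** The preimages of the two segments through [g'] meet, by the converse half of the intersection
    condition, in a vertex [g]. The coordinates of [alpha0 g] and of [g'] are then the [cor] of the
    same two segments. *)
Lemma alpha0_surj g' : vertices T' g' -> exists2 g, vertices T g & alpha0 g = g'.
Proof.
move=> vg'; have [/iso_surj[x hx xE] xh xg] := rhoP redT' true vg'.
have [/iso_surj[y hy yE] yv yg] := rhoP redT' false vg'.
have hxT : horizontal x = true by rewrite -dir // xE.
have hyF : horizontal y = false by rewrite -dir // yE.
have ne : x <> y by move=> E; move: hxT; rewrite E hyF.
case: iso => _ _ meet _ _; have [_ +] := meet _ _ hx hy ne.
case; first by exists g'; rewrite xE yE.
move=> g [gx gy].
have vg : vertices T g by apply: (crossing_vertex hx hy) => //; rewrite hxT hyF.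
exists g => //; apply: coord_inj => b; rewrite coord_alpha0 //.
have xr := rho_unique redT hx vg gx; have yr := rho_unique redT hy vg gy.
rewrite hxT in xr; rewrite hyF in yr.
case: b; rewrite [~~ _]/=; first by rewrite -yr yE (cor_rho redT').
by rewrite -xr xE (cor_rho redT').
Qed.

(** The segment of [alpha x] between the images of the ends of [e] has no further vertex: such a
    vertex would be [alpha0 g] with [g] on [x] and, by order preservation, between the ends of [e].
    Being reduced then makes this segment an edge. *)
Lemma edge_image x e : hMS T x -> edges T e -> seg_set e `<=` seg_set x ->
  exists f, [/\ edges T' f, endpoints f = alpha0 @` endpoints e &
                seg_set f `<=` seg_set (alpha x)].
Proof.
move=> hx Te ex; set g1 := on_line e (lo e); set g2 := on_line e (hi e).
have e1 : endpoints e g1 by left.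
have e2 : endpoints e g2 by right.
have v1 := edge_vertices Te e1; have v2 := edge_vertices Te e2.
have x1 := ex _ (endpoints_seg e1); have x2 := ex _ (endpoints_seg e2).
set b := horizontal x; have be : horizontal e = b := sub_seg_horizontal ex.
have c1 : coord b g1 = lo e by rewrite -be coord_on_line.
have c2 : coord b g2 = hi e by rewrite -be coord_on_line.
have lt12 : coord b (alpha0 g1) < coord b (alpha0 g2).
  by rewrite coord_alpha0_lt // c1 c2 lo_lt_hi.
have /(alpha0_incident hx v1)/seg_setE := x1.
have /(alpha0_incident hx v2)/seg_setE := x2.
rewrite !dir // -/b => -[/andP[_ h2] cor2] [/andP[h1 _] cor1].
(* The proof [lt12] also fixes the implicit bounds [lo f] and [hi f]. *)
pose f := Seg b (cor (alpha x)) lt12.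
have f1 : on_line f (lo f) = alpha0 g1.
  by rewrite /on_line /= -cor1 /coord; case: (b) => /=; case: (alpha0 g1).
have f2 : on_line f (hi f) = alpha0 g2.
  by rewrite /on_line /= -cor2 /coord; case: (b) => /=; case: (alpha0 g2).
have fx : seg_set f `<=` seg_set (alpha x).
  move=> p /seg_setE /= [/andP[p1 p2] pc]; apply/seg_setE; rewrite dir //; split => //.
  by rewrite -/b (le_trans h1 p1) (le_trans p2 h2).
exists f; split => //; last first.
  by rewrite /endpoints f1 f2 image_setU !image_set1.
case: (redT') => _ _ ->; split; last by exists (alpha x) => //; exact: iso_hMS.
apply/seteqP; split => [q [/alpha0_surj[g vg <-] fg]|q fq]; last first.
  split; last exact: endpoints_seg.
  by move: fq => []; rewrite ?f1 ?f2 => ->; exact: alpha0_vertex.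
have xg : seg_set x g by apply/(alpha0_incident hx vg); exact: fx.
have eg : seg_set e g.
  case/seg_setE: fg => /= /andP[l1 l2] _; apply/seg_setE; rewrite be.
  move: l1 l2; rewrite !leNgt !coord_alpha0_lt // -!leNgt c1 c2 => -> ->; split => //.
  rewrite -(on_line_cor e (lo e)) be.
  exact: etrans (seg_set_cor xg) (esym (seg_set_cor x1)).
have : endpoints e g.
  by case: (redT) => _ _ edgesT; move: Te; rewrite edgesT => -[<- _].
by rewrite /endpoints f1 f2 => -[] ->; [left|right].
Qed.

(** The definition of [alpha1] names only some segment containing [e]; [hMS_eq] identifies it with
    [x]. *)
Lemma alpha1P x e : hMS T x -> edges T e -> seg_set e `<=` seg_set x ->
  edges T' (alpha1 T T' alpha e) /\ seg_set (alpha1 T T' alpha e) `<=` seg_set (alpha x).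
Proof.
move=> hx Te ex; have [f [T'f fe fx]] := edge_image hx Te ex.
rewrite /alpha1; set P := [set f | _].
have /getI[T'g _ [y [hy ey gy]]] : P f by split => //; exists x.
by split => //; rewrite (hMS_eq redT hx hy Te ex ey).
Qed.

(** * Transfer of smoothness orders *)

Variables (r r' : seg R -> int).
Hypotheses (smooth_r : smoothness_distribution T r)
  (smooth_r' : smoothness_distribution T' r')
  (const_r : constant_along_MS T r) (const_r' : constant_along_MS T' r')
  (same : same_smoothness T T' alpha r r').

(** Boundary segments have value -1 on both sides. Otherwise one interior edge of [x] and its image
    under [alpha1] determine the two values, by constancy. *)
Lemma r_seg_iso x : hMS T x -> r_seg T' r' (alpha x) = r_seg T r x.
Proof.
move=> hx; case: (iso_MS hx) => [[Mx Mx']|[Bx Bx']]; last by rewrite !r_seg_BMS.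
have [e ei ex] := segment_sub (proj1 Mx); have [Te _] := ei.
have [T'f fx] := alpha1P hx Te ex.
rewrite (r_seg_MS const_r Mx hx Te ex) -(same ei).
exact: r_seg_MS const_r' Mx' (iso_hMS hx) T'f fx.
Qed.

(** * Transfer of weights and of the deletion algorithm *)

Variables (m m' : nat).

Lemma mu_iso g : vertices T g ->
  mu_h T' r' m (alpha0 g) = mu_h T r m g /\ mu_v T' r' m' (alpha0 g) = mu_v T r m' g.
Proof.
move=> vg; have [hh _ _] := rhoP redT true vg; have [hv _ _] := rhoP redT false vg.
have eh : rho_h T' (alpha0 g) = alpha (rho_h T g) := rho_alpha0 true vg.
have ev : rho_v T' (alpha0 g) = alpha (rho_v T g) := rho_alpha0 false vg.
by rewrite /mu_h /mu_v /r_h /r_v eh ev !r_seg_iso.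
Qed.

(** Incidence is carried both ways by [alpha0_incident], and injectivity of [alpha] keeps the
    excluded segment [x] apart from the others. The second components of the states stay free
    because [Mono] reads only the first. *)
Lemma Mono_bij (S S' : state R) x : S.1 `<=` hMS T -> S'.1 = alpha @` S.1 ->
  S.1 x -> set_bij (Mono T S x) (Mono T' S' (alpha x)) alpha0.
Proof.
move=> SM SS' Sx; have hx := SM _ Sx; split.
- move=> g [vg xg gS]; split; first exact: alpha0_vertex.
    exact/alpha0_incident.
  rewrite SS' => y [[z Sz <-] zx] /(alpha0_incident (SM _ Sz) vg).
  by apply: gS; split => // E; apply: zx; rewrite E.
- by move=> g h; rewrite !inE => -[vg _ _] [vh _ _]; exact: alpha0_inj.
- move=> _ [/alpha0_surj[g vg <-] /(alpha0_incident hx vg) xg gS].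
  exists g => //; split => // y [Sy yx] /(alpha0_incident (SM _ Sy) vg).
  apply: gS; split; first by rewrite SS'; exists y.
  by move=> /(iso_inj (SM _ Sy) hx).
Qed.

Lemma abs_weight_iso (S S' : state R) x : S.1 `<=` hMS T -> S'.1 = alpha @` S.1 ->
  S.1 x -> abs_weight T' r' m m' S' (alpha x) = abs_weight T r m m' S x.
Proof.
move=> SM SS' Sx; have bij := Mono_bij SM SS' Sx.
rewrite /abs_weight dir; last exact: SM.
by case: ifP => _; rewrite (reindex_fsbig alpha0 _ _ _ bij); apply: eq_fsbigr => g;
  rewrite inE => -[/mu_iso[]].
Qed.

Lemma diagonalizable_iso (S S' : state R) : S.1 `<=` hMS T -> S'.1 = alpha @` S.1 ->
  Defs.diagonalizable T' r' m m' S' = alpha @` Defs.diagonalizable T r m m' S.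
Proof.
move=> SM SS'; apply/seteqP; split => [y [+ +]|_ [x [Sx wx] <-]].
  rewrite SS' => -[x Sx <-] wx; exists x => //; split => //.
  by move: wx; rewrite (abs_weight_iso SM SS' Sx) /threshold dir //; exact: SM.
split; first by rewrite SS'; exists x.
by rewrite (abs_weight_iso SM SS' Sx) /threshold dir //; exact: SM.
Qed.

Lemma deletion_run_hMS n : (deletion_run T r m m' n).1 `<=` hMS T.
Proof.
move=> x xn; apply: MIS_hMS; have [_ <-] := deletion_run_state T r m m' n.
by left.
Qed.

Lemma deletion_run_iso n :
  (deletion_run T' r' m m' n).1 = alpha @` (deletion_run T r m m' n).1.
Proof.
elim: n => [|n IH]; first by case: iso => _ [_ _ -> _].
have SM := @deletion_run_hMS n; have DE := diagonalizable_iso SM IH.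
rewrite /deletion_run !iterS -!/(deletion_run _ _ _ _ n) /pass /= DE IH.
apply/seteqP; split => [y [[x Sx <-] nD]|_ [x [Sx nD] <-]].
  by exists x => //; split => // Dx; apply: nD; exists x.
split; first by exists x.
(* Injectivity is what lets images commute with set difference. *)
by case=> z [Sz wz] /(iso_inj (SM _ Sz) (SM _ Sx)) E; apply: nD; rewrite -E.
Qed.

Lemma diagonalizable_run_iso n :
  Defs.diagonalizable T' r' m m' (deletion_run T' r' m m' n) =
  alpha @` Defs.diagonalizable T r m m' (deletion_run T r m m' n).
Proof. exact: diagonalizable_iso (@deletion_run_hMS n) (deletion_run_iso n). Qed.

(** Each number is the least index with no diagonalizable segment, and an image is empty exactly
    when its source is, so neither run can stop earlier. *)
Lemma first_stop_iso : first_stop T' r' m m' = first_stop T r m m'.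
Proof.
have D0 n : Defs.diagonalizable T' r' m m' (deletion_run T' r' m m' n) = set0 <->
    Defs.diagonalizable T r m m' (deletion_run T r m m' n) = set0.
  rewrite diagonalizable_run_iso; split => [/image_set0_set0//|->].
  exact: image_set0.
have [/D0 s' l'] := first_stopP T' r' m m'.
have [/D0 s l] := first_stopP T r m m'.
have [lt|lt|//] := ltngtP (first_stop T' r' m m') (first_stop T r m m').
  by case: (l _ lt).
by case: (l' _ lt).
Qed.

End Isomorphism.

Theorem theorem3p18 (R : realType) (m m' : nat) (T T' : tmesh R)
    (redT : reduced T) (redT' : reduced T')
    (r r' : seg R -> int)
    (smooth_r : smoothness_distribution T r)
    (smooth_r' : smoothness_distribution T' r')
    (const_r : constant_along_MS T r)
    (const_r' : constant_along_MS T' r')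
    (alpha : seg R -> seg R)
    (iso : structural_isomorphism T T' alpha)
    (dir : direction_preserving T alpha)
    (same : same_smoothness T T' alpha r r') :
  alpha @` CNDC T r m m' = CNDC T' r' m m'.
Proof.
by rewrite /CNDC (first_stop_iso redT redT' iso dir smooth_r smooth_r' const_r const_r' same)
  (deletion_run_iso redT redT' iso dir smooth_r smooth_r' const_r const_r' same).
Qed.
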